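(* Let $k$ be a positive integer and let $\mathcal{A}^{(k)}$ be the set of all $k$-block Arndt compositions (of all weights $n\ge0$). Then $$\sum_{\sigma\in\mathcal{A}^{(k)}}x^{|\sigma|}y^{\mathrm{parts}(\sigma)}=\frac{1}{1-J_k(x,y)}\sum_{j=0}^{k-1}J_j(x,y),$$ where $J_0(x,y)=1$ and $J_j(x,y)=x^{\binom{j+1}{2}}y^j\prod_{\ell=1}^j\frac{1}{1-x^{\ell}}$ for $j\geq 1$.
   Context: A composition of $n\ge0$ is a finite sequence $\sigma=(\sigma_1,\dots,\sigma_\ell)$ of positive integers summing to $n=|\sigma|$, with $\mathrm{parts}(\sigma)=\ell$ (the empty composition is the composition of $0$ with $0$ parts). For a positive integer $k$, a $k$-block Arndt composition is a composition such that $\sigma_{ki-(k-1)}>\sigma_{ki-(k-2)}>\cdots>\sigma_{ki}$ for each positive integer $i$, where only the indices not exceeding $\ell$ are involved; equivalently, $\sigma_j>\sigma_{j+1}$ for every $j$ with $1\le j<\ell$ that is not a multiple of $k$ (so each consecutive block of $k$ parts, including a final incomplete block, is strictly decreasing). *)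

(* Defs.v *)
From HB Require Import structures.
From mathcomp Require Import all_boot all_order all_algebra.
From mathcomp Require Import boolp classical_sets cardinality fsbigop.

Set Implicit Arguments.
Unset Strict Implicit.
Unset Printing Implicit Defensive.

Import GRing.Theory.

Local Open Scope ring_scope.

(* Formal power series over R.  The bivariate ring Z[[x, y]] is represented
   below as Z[[y]][[x]] = fps (fps int), so that for F : fps (fps int) the
   coefficient of x^n y^m is F n m. *)
Record fps (R : Type) := Fps { fps_coef :> nat -> R }.

Lemma fpsP (R : Type) (f g : fps R) : (forall n, f n = g n) -> f = g.
Proof. by case: f g => f [g] /= fg; congr Fps; apply/funext. Qed.

HB.instance Definition _ (R : Type) := gen_eqMixin (fps R).
HB.instance Definition _ (R : Type) := gen_choiceMixin (fps R).

Section FpsZmodule.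
Variable R : zmodType.
Implicit Types f g h : fps R.

Definition fps_zero : fps R := Fps (fun=> 0).
Definition fps_opp f : fps R := Fps (fun n => - f n).
Definition fps_add f g : fps R := Fps (fun n => f n + g n).

Fact fps_addA : associative fps_add.
Proof. by move=> f g h; apply: fpsP => n /=; rewrite addrA. Qed.
Fact fps_addC : commutative fps_add.
Proof. by move=> f g; apply: fpsP => n /=; rewrite addrC. Qed.
Fact fps_add0 : left_id fps_zero fps_add.
Proof. by move=> f; apply: fpsP => n /=; rewrite add0r. Qed.
Fact fps_addN : left_inverse fps_zero fps_opp fps_add.
Proof. by move=> f; apply: fpsP => n /=; rewrite addNr. Qed.

HB.instance Definition _ :=
  GRing.isZmodule.Build (fps R) fps_addA fps_addC fps_add0 fps_addN.

Lemma coef_fps0 n : (0 : fps R) n = 0. Proof. by []. Qed.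
Lemma coef_fpsN f n : (- f) n = - f n. Proof. by []. Qed.
Lemma coef_fpsD f g n : (f + g) n = f n + g n. Proof. by []. Qed.
Lemma coef_fpsB f g n : (f - g) n = f n - g n. Proof. by []. Qed.

End FpsZmodule.

Section FpsRing.
Variable R : comNzRingType.
Implicit Types f g h : fps R.

Definition fps_const (c : R) : fps R := Fps (fun n => if n == 0%N then c else 0).
Definition fps_var : fps R := Fps (fun n => (n == 1%N)%:R).
Definition fps_mul f g : fps R := Fps (fun n => \sum_(i < n.+1) f i * g (n - i)%N).

Fact fps_mul_rev f g n : fps_mul f g n = \sum_(i < n.+1) f (n - i)%N * g i.
Proof.
rewrite /= (reindex_inj rev_ord_inj) /=; apply: eq_bigr => i _.
by rewrite subSS subKn // -ltnS.
Qed.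

Fact fps_mulC : commutative fps_mul.
Proof.
move=> f g; apply: fpsP => n; rewrite fps_mul_rev /=.
by apply: eq_bigr => i _; rewrite mulrC.
Qed.

Fact fps_mulA : associative fps_mul.
Proof.
move=> p q r; apply: fpsP => i; rewrite [RHS]fps_mul_rev.
transitivity (\sum_(j < i.+1) p j * (fps_mul q r) (i - j)%N) => //.
pose coef3 j k := p j * (q (i - j - k)%N * r k).
transitivity (\sum_(j < i.+1) \sum_(k < i.+1 | (k <= i - j)%N) coef3 j k).
  apply: eq_bigr => j _; rewrite fps_mul_rev big_distrr /=.
  by rewrite (big_ord_narrow_leq (leq_subr _ _)).
rewrite (exchange_big_dep predT) //=; apply: eq_bigr => k _.
transitivity (\sum_(j < i.+1 | (j <= i - k)%N) coef3 j k).
  apply: eq_bigl => j; rewrite -ltnS -(ltnS j) -!subSn ?leq_ord //.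
  by rewrite -subn_gt0 -(subn_gt0 j) -!subnDA addnC.
rewrite (big_ord_narrow_leq (leq_subr _ _)) big_distrl /=.
by apply: eq_bigr => j _; rewrite /coef3 -!subnDA addnC mulrA.
Qed.

Fact fps_mul1 : left_id (fps_const 1) fps_mul.
Proof.
move=> f; apply: fpsP => n /=.
by rewrite big_ord_recl /= subn0 mul1r big1 ?addr0 // => i _; rewrite mul0r.
Qed.

Fact fps_mulDl : left_distributive fps_mul +%R.
Proof.
move=> f g h; apply: fpsP => n /=; rewrite -big_split /=.
by apply: eq_bigr => i _; rewrite mulrDl.
Qed.

Fact fps_const1_neq0 : fps_const 1 != 0.
Proof.
apply/eqP => /(congr1 (fun f : fps R => f 0%N)) /= /eqP.
by rewrite oner_eq0.
Qed.

HB.instance Definition _ := GRing.Zmodule_isComNzRing.Build (fps R)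
  fps_mulA fps_mulC fps_mul1 fps_mulDl fps_const1_neq0.

Lemma coef_fps1 n : (1 : fps R) n = (n == 0%N)%:R.
Proof. by case: n. Qed.

Lemma coef_fpsM f g n : (f * g) n = \sum_(i < n.+1) f i * g (n - i)%N.
Proof. by []. Qed.

Lemma coef0_fpsM f g : (f * g) 0%N = f 0%N * g 0%N.
Proof. by rewrite coef_fpsM big_ord1. Qed.

End FpsRing.

Arguments fps_var {R}.

Section FpsUnit.
Variable R : comUnitRingType.
Implicit Types f g : fps R.

Definition fps_unit : {pred fps R} := fun f => f 0%N \is a GRing.unit.

(* The coefficients g_0, ..., g_n of the inverse of f, determined by
   f_0 g_0 = 1 and \sum_(i <= n) f_i g_(n - i) = 0 for n > 0. *)
Fixpoint fps_inv_seq f n : seq R :=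
  if n is m.+1 then
    let s := fps_inv_seq f m in
    rcons s (- (f 0%N)^-1 * \sum_(i < m.+1) f i.+1 * s`_(m - i))
  else [:: (f 0%N)^-1].

Definition fps_inv f : fps R :=
  if f \in fps_unit then Fps (fun n => (fps_inv_seq f n)`_n) else f.

Fact size_fps_inv_seq f n : size (fps_inv_seq f n) = n.+1.
Proof. by elim: n => //= n IHn; rewrite size_rcons IHn. Qed.

Fact nth_fps_inv_seq f n i :
  (i <= n)%N -> (fps_inv_seq f n)`_i = (fps_inv_seq f i)`_i.
Proof.
elim: n => [|n IHn]; first by rewrite leqn0 => /eqP->.
rewrite leq_eqVlt => /orP[/eqP-> //|lt_in].
by rewrite /= nth_rcons size_fps_inv_seq lt_in IHn.
Qed.

Fact fps_mulV : {in fps_unit, left_inverse 1 fps_inv *%R}.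
Proof.
move=> f Uf; rewrite mulrC /fps_inv Uf; apply: fpsP => n.
rewrite coef_fpsM coef_fps1; case: n => [|n].
  by rewrite big_ord1 /= divrr.
rewrite big_ord_recl subn0 /= nth_rcons size_fps_inv_seq ltnn eqxx.
rewrite mulrA mulrN divrr // mulN1r addrC; apply/eqP; rewrite subr_eq0.
apply/eqP; apply: eq_bigr => i _; congr (_ * _).
by rewrite [RHS]nth_fps_inv_seq ?leq_subr // /bump /= add1n subSS.
Qed.

Fact fps_unitPl f g : g * f = 1 -> fps_unit f.
Proof.
move=> /(congr1 (fun h : fps R => h 0%N)); rewrite coef0_fpsM => gf1.
by apply/unitrP; exists (g 0%N); rewrite [_ * g _]mulrC gf1.
Qed.

Fact fps_inv_out : {in [predC fps_unit], fps_inv =1 id}.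
Proof. by move=> f; rewrite inE /= /fps_inv => /negbTE->. Qed.

HB.instance Definition _ := GRing.ComNzRing_hasMulInverse.Build (fps R)
  fps_mulV fps_unitPl fps_inv_out.

Lemma fps_unitE f : (f \is a GRing.unit) = (f 0%N \is a GRing.unit).
Proof. by []. Qed.

End FpsUnit.

(* Unconditional formal summation of a family in R[[x, y]]: every monomial
   occurs in finitely many terms, and coefficients add up. *)
Definition fps2_has_sum (R : zmodType) (T : choiceType) (A : set T)
    (F : T -> fps (fps R)) (S : fps (fps R)) : Prop :=
  forall n m,
    finite_set [set t | A t /\ F t n m <> 0]%classic /\
    \sum_(t \in A) F t n m = S n m.

Definition is_composition (s : seq nat) : bool := all (fun p => 0 < p)%N s.

(* The j-th part, 1-indexed. *)
Definition part (s : seq nat) (j : nat) : nat := nth 0%N s j.-1.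

Definition block_arndt (k : nat) : set (seq nat) :=
  fun s => is_composition s /\
    forall i j : nat, (0 < i)%N ->
      (k * i - (k - 1) <= j)%N -> (j < k * i)%N -> (j < size s)%N ->
      (part s j > part s j.+1)%N.

Definition xvar : fps (fps int) := fps_var.
Definition yvar : fps (fps int) := fps_const fps_var.

Definition J (j : nat) : fps (fps int) :=
  if j is 0 then 1
  else xvar ^+ 'C(j.+1, 2) * yvar ^+ j *
       \prod_(1 <= l < j.+1) (1 - xvar ^+ l)^-1.

Lemma coef0_xvarX l : (0 < l)%N -> (xvar ^+ l) 0%N = 0.
Proof. by case: l => // l _; rewrite exprS coef0_fpsM mul0r. Qed.

Lemma unit_1BxvarX l : (0 < l)%N -> 1 - xvar ^+ l \is a GRing.unit.
Proof. by move=> l0; rewrite fps_unitE coef_fpsB coef0_xvarX // subr0 unitr1. Qed.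

Lemma unit_1BJ k : (0 < k)%N -> 1 - J k \is a GRing.unit.
Proof.
case: k => // k _; rewrite fps_unitE coef_fpsB /J !coef0_fpsM coef0_xvarX.
  by rewrite !mul0r subr0 unitr1.
by rewrite bin_gt0.
Qed.

(* Main.v *)
Require Import Defs.
From mathcomp Require Import all_boot all_order all_algebra.
From mathcomp Require Import boolp classical_sets functions cardinality fsbigop.
From mathcomp Require Import zify.

(** Cutting off its first [k] parts decomposes a [k]-block Arndt composition
    uniquely as a strict partition with [k] parts followed by a [k]-block Arndt
    composition, unless it has fewer than [k] parts and is itself a strict
    partition.  Hence the generating function [S] satisfies
    [S = \sum_(j < k) D j + D k * S], where [D j] counts the strict partitions
    with [j] parts.  Lowering all parts by one leaves [j] positive parts, or
    [j - 1] positive parts followed by a zero, so that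
    [D j = x ^ j * (D j + y * D (j - 1))]; this recurrence gives [D j = J j]. *)

Set Implicit Arguments.
Unset Strict Implicit.
Unset Printing Implicit Defensive.

Import GRing.Theory.

Local Open Scope classical_set_scope.
Local Open Scope ring_scope.

(** * Sums of finitely supported families *)

Definition has_fsum (T : choiceType) (V : nmodType) (A : set T) (f : T -> V)
    (v : V) : Prop :=
  finite_set [set t | A t /\ f t <> 0] /\ \sum_(t \in A) f t = v.

Section HasFsum.
Variables (T : choiceType) (V : nmodType).
Implicit Types (A B : set T) (f g : T -> V) (v w : V).

Lemma has_fsum_finite A f v :
  finite_set A -> has_fsum A f v <-> \sum_(t \in A) f t = v.
Proof.
by move=> finA; split=> [[]//|]; split=> //; apply: sub_finite_set finA => t [].
Qed.

Lemma has_fsum_widen B A f v :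
  B `<=` A -> (forall t, A t -> ~ B t -> f t = 0) ->
  has_fsum B f v <-> has_fsum A f v.
Proof.
move=> BA f0; rewrite /has_fsum (fsbig_widen B A) //; last by move=> t [/f0].
suff -> : [set t | B t /\ f t <> 0] = [set t | A t /\ f t <> 0] by [].
apply/seteqP; split=> t /= [st ft]; split=> //; first exact: BA.
by apply: contrapT => /(f0 t st).
Qed.

Lemma has_fsum_support A f v :
  has_fsum A f v ->
  exists B, [/\ finite_set B, B `<=` A, forall t, A t -> ~ B t -> f t = 0 &
    \sum_(t \in B) f t = v].
Proof.
move=> Afv; pose B := [set t | A t /\ f t <> 0]; exists B.
have BA : B `<=` A by move=> t [].
have f0 t : A t -> ~ B t -> f t = 0 by move=> At /not_andP[//|/contrapT].
have finB : finite_set B by case: Afv.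
by split=> //; apply/(has_fsum_finite _ _ finB)/(has_fsum_widen _ BA).
Qed.

Lemma eq_has_fsum A f g v :
  (forall t, A t -> f t = g t) -> has_fsum A f v -> has_fsum A g v.
Proof.
move=> fg [fin_f <-]; split; last by apply: eq_fsbigr => t /set_mem /fg.
by apply: sub_finite_set fin_f => t [At gt]; split; rewrite ?fg.
Qed.

Lemma has_fsum_set0 f : has_fsum set0 f 0.
Proof. by apply/has_fsum_finite; rewrite ?fsbig_set0. Qed.

Lemma has_fsum_set1 t f : has_fsum [set t] f (f t).
Proof. by apply/has_fsum_finite; rewrite ?fsbig_set1. Qed.

Lemma has_fsum_setU A B f v w :
  A `&` B `<=` set0 -> has_fsum A f v -> has_fsum B f w ->
  has_fsum (A `|` B) f (v + w).
Proof.
move=> AB0 /has_fsum_support[A' [finA' A'A f0A <-]].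
move=> /has_fsum_support[B' [finB' B'B f0B <-]].
apply/(@has_fsum_widen (A' `|` B')); first exact: setUSS.
  by move=> t [At|Bt] /not_orP[nA' nB']; [apply: f0A|apply: f0B].
apply/has_fsum_finite; first by rewrite finite_setU.
by apply: fsbigU0 => // t [/A'A At /B'B Bt]; apply: (AB0 t).
Qed.

Lemma has_fsumD A f g v w :
  has_fsum A f v -> has_fsum A g w -> has_fsum A (fun t => f t + g t) (v + w).
Proof.
move=> Afv Agw.
pose B := [set t | A t /\ f t <> 0] `|` [set t | A t /\ g t <> 0].
have finB : finite_set B by rewrite finite_setU; split; [case: Afv|case: Agw].
have BA : B `<=` A by move=> t [[]|[]].
have f0 t : A t -> ~ B t -> f t = 0.
  by move=> At nBt; apply: contrapT => ft; apply: nBt; left.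
have g0 t : A t -> ~ B t -> g t = 0.
  by move=> At nBt; apply: contrapT => gt; apply: nBt; right.
move: Afv Agw => /(has_fsum_widen _ BA f0)/(has_fsum_finite _ _ finB) <-.
move=> /(has_fsum_widen _ BA g0)/(has_fsum_finite _ _ finB) <-.
apply/(has_fsum_widen _ BA) => [t At nBt|]; first by rewrite f0 ?g0 ?addr0.
by apply/has_fsum_finite; rewrite ?fsbig_split.
Qed.

Lemma has_fsum_sum A (I : Type) (r : seq I) (f : I -> T -> V) (v : I -> V) :
  (forall i, has_fsum A (f i) (v i)) ->
  has_fsum A (fun t => \sum_(i <- r) f i t) (\sum_(i <- r) v i).
Proof.
move=> Afv; elim: r => [|i r IHr].
  rewrite big_nil; apply/(@has_fsum_widen set0) => // [t _ _|].
    by rewrite big_nil.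
  exact: has_fsum_set0.
rewrite big_cons; under eq_fun do rewrite big_cons.
exact: has_fsumD.
Qed.

End HasFsum.

Lemma has_fsum_image (T U : choiceType) (V : nmodType) (h : T -> U) (A : set T)
    (f : U -> V) v :
  set_inj A h -> has_fsum A (f \o h) v -> has_fsum (h @` A) f v.
Proof.
move=> h_inj [fin_fh <-]; split; last by rewrite fsbig_image.
by apply: sub_finite_set (finite_image h fin_fh) => _ [[t At <-] ft]; exists t.
Qed.

Lemma has_fsumZ (T : choiceType) (R : pzSemiRingType) (A : set T) (c : R)
    (f : T -> R) v :
  has_fsum A f v -> has_fsum A (fun t => c * f t) (c * v).
Proof.
move=> [fin_f <-]; split; last by rewrite full_fsbig_distrr.
apply: sub_finite_set fin_f => t [At cft]; split=> // ft.
by rewrite ft mulr0 in cft.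
Qed.

Lemma has_fsumM (T U : choiceType) (R : pzSemiRingType) (A : set T) (B : set U)
    (f : T -> R) (g : U -> R) v w :
  has_fsum A f v -> has_fsum B g w ->
  has_fsum (A `*` B) (fun p => f p.1 * g p.2) (v * w).
Proof.
move=> /has_fsum_support[A' [finA' A'A f0 <-]].
move=> /has_fsum_support[B' [finB' B'B g0 <-]].
apply/(@has_fsum_widen _ _ (A' `*` B')); first exact: setSX.
  move=> [t u] [/= At Bu] /not_andP[nA't|nB'u].
    by rewrite f0 ?mul0r.
  by rewrite g0 ?mulr0.
apply/has_fsum_finite; first exact: finite_setX.
rewrite -(pair_fsbig _ (fun t u => f t * g u)) //.
rewrite !fsbig_finite // mulr_suml; apply: eq_bigr => t _.
by rewrite fsbig_finite // mulr_sumr.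
Qed.

(** * Coefficients of power series *)

Section Coefficients.
Variable R : comNzRingType.
Implicit Types (f : fps R) (c : R) (F G : fps (fps R)).

Lemma coef_fps_sum (V : zmodType) (I : Type) (r : seq I) (F : I -> fps V) n :
  (\sum_(i <- r) F i) n = \sum_(i <- r) F i n.
Proof. by elim/big_rec2: _ => // i f g _ <-. Qed.

Lemma coef_fps2M F G n m :
  (F * G) n m =
  \sum_(i < n.+1) \sum_(j < m.+1) F i j * G (n - i)%N (m - j)%N.
Proof. by rewrite coef_fpsM coef_fps_sum. Qed.

Lemma coef_fps_varM f n :
  (fps_var * f) n = if n is m.+1 then f m else 0.
Proof.
rewrite coef_fpsM; case: n => [|n]; first by rewrite big_ord1 mul0r.
rewrite big_ord_recl mul0r add0r big_ord_recl mul1r subSS subn0.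
by rewrite big1 ?addr0 // => i _; rewrite mul0r.
Qed.

Lemma coef_fps_varX a n : (fps_var ^+ a : fps R) n = (n == a)%:R.
Proof.
elim: a n => [|a IHa] n; first by rewrite expr0 coef_fps1.
by rewrite exprS coef_fps_varM; case: n.
Qed.

Lemma coef_fpsM_const f c n : (f * fps_const c) n = f n * c.
Proof.
rewrite coef_fpsM big_ord_recr /= subnn big1 ?add0r // => i _.
by rewrite subn_eq0 leqNgt ltn_ord mulr0.
Qed.

Lemma fps_constX c b : fps_const c ^+ b = fps_const (c ^+ b).
Proof.
elim: b => // b IHb; rewrite !exprSr IHb; apply: fpsP => n.
by rewrite coef_fpsM_const /=; case: eqP => // _; rewrite mul0r.
Qed.

End Coefficients.

Lemma coef_monomial a b n m :
  (xvar ^+ a * yvar ^+ b) n m = ((n == a) && (m == b))%:R.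
Proof.
rewrite /xvar /yvar fps_constX coef_fpsM_const coef_fps_varX -mulnb natrM.
by case: eqP => _; rewrite ?mul1r ?coef_fps_varX ?mul0r.
Qed.

(** * Formal summation of bivariate power series *)

Section Fps2HasSum.
Variables (T : choiceType) (R : zmodType).
Implicit Types (A B : set T) (F G : T -> fps (fps R)) (S : fps (fps R)).

Lemma fps2_has_sumE A F S :
  fps2_has_sum A F S <->
  forall n m, has_fsum A (fun t => F t n m) (S n m).
Proof. by []. Qed.

Lemma fps2_has_sum_exists A F :
  (forall n m, finite_set [set t | A t /\ F t n m <> 0]) ->
  exists S, fps2_has_sum A F S.
Proof.
by move=> finF; exists (Fps (fun n => Fps (fun m => \sum_(t \in A) F t n m))).
Qed.

Lemma fps2_has_sum_unique A F S S' :
  fps2_has_sum A F S -> fps2_has_sum A F S' -> S = S'.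
Proof.
move=> AFS AFS'; apply: fpsP => n; apply: fpsP => m.
by have [_ <-] := AFS n m; have [_ <-] := AFS' n m.
Qed.

Lemma eq_fps2_has_sum A F G S :
  (forall t, A t -> F t = G t) -> fps2_has_sum A F S -> fps2_has_sum A G S.
Proof. by move=> FG AFS n m; apply: eq_has_fsum (AFS n m) => t /FG ->. Qed.

Lemma fps2_has_sum_set1 t F : fps2_has_sum [set t] F (F t).
Proof. by move=> n m; apply: has_fsum_set1. Qed.

Lemma fps2_has_sum_setU A B F S S' :
  A `&` B `<=` set0 -> fps2_has_sum A F S -> fps2_has_sum B F S' ->
  fps2_has_sum (A `|` B) F (S + S').
Proof. by move=> AB0 AFS BFS' n m; apply: has_fsum_setU. Qed.

Lemma fps2_has_sum_bigcup (A : nat -> set T) F (S : nat -> fps (fps R)) k :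
  trivIset setT A -> (forall j, fps2_has_sum (A j) F (S j)) ->
  fps2_has_sum (\bigcup_(j < k) A j) F (\sum_(0 <= j < k) S j).
Proof.
move=> trivA AFS; elim: k => [|k IHk].
  by rewrite II0 bigcup_set0 big_geq // => n m; apply: has_fsum_set0.
rewrite IIS bigcup_setU bigcup_set1 big_nat_recr //=.
apply: fps2_has_sum_setU => // t [[j /= ltjk Ajt] Akt].
have jk : j = k by apply: (trivA _ _ Logic.I Logic.I); exists t.
by rewrite jk ltnn in ltjk.
Qed.

End Fps2HasSum.

Lemma fps2_has_sum_image (R : zmodType) (T U : choiceType) (h : T -> U)
    (A : set T) (F : U -> fps (fps R)) S :
  set_inj A h -> fps2_has_sum A (F \o h) S -> fps2_has_sum (h @` A) F S.
Proof. by move=> h_inj AFS n m; apply: has_fsum_image (AFS n m). Qed.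

Lemma fps2_has_sumZ (R : comNzRingType) (T : choiceType) (A : set T)
    (C : fps (fps R)) (F : T -> fps (fps R)) S :
  fps2_has_sum A F S -> fps2_has_sum A (fun t => C * F t) (C * S).
Proof.
move=> /fps2_has_sumE AFS; apply/fps2_has_sumE => n m.
rewrite coef_fps2M; under eq_fun do rewrite coef_fps2M.
by do 2![apply: has_fsum_sum => ?]; apply: has_fsumZ (AFS _ _).
Qed.

Lemma fps2_has_sumM (R : comNzRingType) (T U : choiceType) (A : set T)
    (B : set U) (F : T -> fps (fps R)) (G : U -> fps (fps R)) S S' :
  fps2_has_sum A F S -> fps2_has_sum B G S' ->
  fps2_has_sum (A `*` B) (fun p => F p.1 * G p.2) (S * S').
Proof.
move=> /fps2_has_sumE AFS /fps2_has_sumE BGS'; apply/fps2_has_sumE => n m.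
rewrite coef_fps2M; under eq_fun do rewrite coef_fps2M.
by do 2![apply: has_fsum_sum => ?]; exact: has_fsumM (AFS _ _) (BGS' _ _).
Qed.

(** * Generating functions of sets of sequences *)

Definition weight (s : seq nat) : fps (fps int) :=
  xvar ^+ sumn s * yvar ^+ size s.

Lemma weight_cat s t : weight (s ++ t) = weight s * weight t.
Proof. by rewrite /weight sumn_cat size_cat !exprD mulrACA. Qed.

Lemma weight_map_succn s : weight (map succn s) = xvar ^+ size s * weight s.
Proof.
rewrite /weight size_map mulrA -exprD; congr (_ ^+ _ * _).
by elim: s => //= a s ->; rewrite addSn addnCA.
Qed.

Lemma finite_sumn_size n m :
  finite_set [set s : seq nat | sumn s = n /\ size s = m].
Proof.
apply: (@sub_finite_set _ _
  ((fun t : m.-tuple 'I_n.+1 => map val t) @` [set: m.-tuple 'I_n.+1])).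
  move=> s [sumn_s /eqP size_s]; exists (map_tuple inord (Tuple size_s)) => //=.
  rewrite -map_comp map_id_in // => a s_a /=.
  by rewrite inordK // ltnS -sumn_s (perm_sumn (perm_to_rem s_a)) leq_addr.
exact/finite_image/finite_finset.
Qed.

Lemma fps2_has_sum_weight_exists (A : set (seq nat)) :
  exists S, fps2_has_sum A weight S.
Proof.
apply: fps2_has_sum_exists => n m.
apply: sub_finite_set (finite_sumn_size n m) => s [_].
by rewrite /weight coef_monomial; case: eqP => // ->; case: eqP => // ->.
Qed.

Lemma fps2_has_sum_weight_rec (A : set (seq nat)) (B C : fps (fps int)) :
  1 - C \is a GRing.unit ->
  (forall S, fps2_has_sum A weight S -> fps2_has_sum A weight (B + C * S)) ->
  fps2_has_sum A weight ((1 - C)^-1 * B).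
Proof.
move=> unit_1BC rec; have [S AS] := fps2_has_sum_weight_exists A.
suff <- : S = (1 - C)^-1 * B by [].
apply: (mulrI unit_1BC); rewrite mulVKr // mulrBl mul1r.
by rewrite {1}(fps2_has_sum_unique AS (rec S AS)) addrK.
Qed.

Lemma fps2_has_sum_cat (A B : set (seq nat)) k S S' :
  A `<=` [set s | size s = k] ->
  fps2_has_sum A weight S -> fps2_has_sum B weight S' ->
  fps2_has_sum ((fun p => p.1 ++ p.2) @` (A `*` B)) weight (S * S').
Proof.
move=> sizeA AS BS'; apply: fps2_has_sum_image.
  move=> [s t] [s' t'] /set_mem[/= /sizeA sz_s _] /set_mem[/= /sizeA sz_s' _].
  by move=> /eqP; rewrite eqseq_cat ?sz_s ?sz_s' // => /andP[/eqP-> /eqP->].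
by apply: eq_fps2_has_sum (fps2_has_sumM AS BS') => p _ /=; rewrite weight_cat.
Qed.

Lemma fps2_has_sum_rcons (A : set (seq nat)) a S :
  fps2_has_sum A weight S ->
  fps2_has_sum (rcons^~ a @` A) weight (weight [:: a] * S).
Proof.
move=> AS; apply: fps2_has_sum_image; first by move=> s t _ _ /rcons_inj[].
apply: eq_fps2_has_sum (fps2_has_sumZ _ AS) => s _ /=.
by rewrite -cats1 weight_cat mulrC.
Qed.

Lemma fps2_has_sum_map_succn (A : set (seq nat)) k S :
  A `<=` [set s | size s = k] -> fps2_has_sum A weight S ->
  fps2_has_sum (map succn @` A) weight (xvar ^+ k * S).
Proof.
move=> sizeA AS; apply: fps2_has_sum_image.
  by move=> s t _ _; apply/inj_map/succn_inj.
apply: eq_fps2_has_sum (fps2_has_sumZ _ AS) => s /sizeA <- /=.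
by rewrite weight_map_succn.
Qed.

(** * Strict partitions *)

Definition decreasing_seqs (j : nat) : set (seq nat) :=
  [set s | size s = j /\ sorted gtn s].

Definition strict_partitions (j : nat) : set (seq nat) :=
  [set s | [/\ is_composition s, size s = j & sorted gtn s]].

Lemma sorted_gtn_rcons s a :
  sorted gtn (rcons s a) = all (ltn a) s && sorted gtn s.
Proof.
have gtn_trans : transitive gtn by move=> b c d /= bc db; apply: ltn_trans bc.
by rewrite !sorted_pairwise // pairwise_rcons.
Qed.

Lemma strict_partitionsE j :
  strict_partitions j = map succn @` decreasing_seqs j.
Proof.
apply/seteqP; split=> [s [s_pos sz_s s_dec]|_ [s [sz_s s_dec] <-]].
  have succ_pred : map succn (map predn s) = s.
    by rewrite -map_comp map_id_in // => a /(allP s_pos) /prednK.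
  exists (map predn s) => //; split; first by rewrite size_map.
  by rewrite -succ_pred sorted_map in s_dec.
by split; rewrite ?size_map ?sorted_map // /is_composition all_map; apply/allP.
Qed.

Lemma decreasing_seqsS j :
  decreasing_seqs j.+1 =
  strict_partitions j.+1 `|` rcons^~ 0%N @` strict_partitions j.
Proof.
apply/seteqP; split=> [s [+ +]|s [[]|[t [t_pos sz_t t_dec] <-]]] //; last first.
  by split; rewrite ?size_rcons ?sz_t // sorted_gtn_rcons t_dec andbT.
case/lastP: s => // s a; rewrite size_rcons sorted_gtn_rcons.
move=> [sz_s] /andP[s_gt s_dec]; case: a s_gt => [|a] s_gt.
  by right; exists s.
left; split; rewrite ?size_rcons ?sz_s // ?sorted_gtn_rcons ?s_gt //.
rewrite /is_composition all_rcons; apply: sub_all s_gt => b.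
exact: ltn_trans.
Qed.

Lemma trivIset_strict_partitions : trivIset setT strict_partitions.
Proof. by move=> i j _ _ [s [[_ <- _] [_ <- _]]]. Qed.

Lemma JE j :
  J j = xvar ^+ 'C(j.+1, 2) * yvar ^+ j *
        \prod_(1 <= l < j.+1) (1 - xvar ^+ l)^-1.
Proof. by case: j => //; rewrite big_geq // !mulr1. Qed.

Lemma JS j :
  J j.+1 = (1 - xvar ^+ j.+1)^-1 * (xvar ^+ j.+1 * (yvar * J j)).
Proof.
rewrite !JE big_nat_recr //= binS bin1 exprD [yvar ^+ _]exprS.
by rewrite [LHS](AC (2*2*2) (6*(2*(3*(1*4*5))))).
Qed.

Lemma fps2_has_sum_strict_partitions j :
  fps2_has_sum (strict_partitions j) weight (J j).
Proof.
elim: j => [|j IHj].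
  have -> : strict_partitions 0 = [set [::]].
    by apply/seteqP; split=> [s [_ /size0nil]|_ ->].
  have -> : J 0 = weight [::] by rewrite /weight !expr0 mulr1.
  exact: fps2_has_sum_set1.
rewrite JS; apply: fps2_has_sum_weight_rec => [|S strict_S].
  exact: unit_1BxvarX.
rewrite -mulrDr addrC strict_partitionsE.
apply: fps2_has_sum_map_succn => [s []//|]; rewrite decreasing_seqsS.
have -> : yvar = weight [:: 0%N] by rewrite /weight expr0 mul1r expr1.
apply: fps2_has_sum_setU => //; last exact: fps2_has_sum_rcons.
move=> s [[s_pos _ _] [t _ ts]].
by rewrite -ts /is_composition all_rcons in s_pos.
Qed.

(** * Block Arndt compositions *)

Lemma ndvdn_blockP k j : (0 < k)%N ->
  reflect (exists i, [/\ (0 < i)%N, (k * i - (k - 1) <= j)%N & (j < k * i)%N])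
          (~~ (k %| j)%N).
Proof.
move=> k_gt0; apply: (iffP idP) => [ndvd|[i [i_gt0 le_ij lt_ji]]].
  exists (j %/ k).+1; have := ltn_pmod j k_gt0; have := divn_eq j k.
  move: ndvd; rewrite /dvdn mulnS (mulnC k).
  by move: (j %/ k * k)%N (j %% k)%N => m r ? ? ?; split=> //; lia.
apply/dvdnP => -[q j_eq]; rewrite j_eq mulnC ltn_pmul2l // in lt_ji.
by have := leq_mul (leqnn k) lt_ji; rewrite mulnS j_eq in le_ij *; lia.
Qed.

Lemma block_arndtP k s : (0 < k)%N ->
  block_arndt k s <-> is_composition s /\
    forall j, (j.+1 < size s)%N -> ~~ (k %| j.+1)%N ->
      (nth 0 s j.+1 < nth 0 s j)%N.
Proof.
move=> k_gt0; split=> -[s_pos s_dec]; split=> //.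
  move=> j lt_js /(ndvdn_blockP _ k_gt0)[i [i_gt0 le_ij lt_ji]].
  exact: (s_dec i j.+1).
move=> i [|j] i_gt0 le_ij lt_ji lt_js; first by move: le_ij; nia.
by apply: s_dec => //; apply/ndvdn_blockP => //; exists i.
Qed.

Lemma block_arndt_short k s : (0 < k)%N -> (size s <= k)%N ->
  block_arndt k s <-> strict_partitions (size s) s.
Proof.
move=> k_gt0 le_sk; rewrite block_arndtP //.
split=> [[s_pos s_dec]|[s_pos _ /(sortedP 0%N) s_dec]]; split=> //.
  apply/(sortedP 0%N) => j lt_js; apply: s_dec => //.
  by rewrite gtnNdvd // (leq_trans lt_js).
by move=> j /s_dec.
Qed.

Lemma block_arndt_cat k u v : (0 < k)%N -> (k %| size u)%N ->
  block_arndt k (u ++ v) <-> block_arndt k u /\ block_arndt k v.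
Proof.
move=> k_gt0 k_u; rewrite !block_arndtP // /is_composition all_cat size_cat.
have nth_u i : (i < size u)%N -> nth 0%N (u ++ v) i = nth 0%N u i.
  by move=> lt_iu; rewrite nth_cat lt_iu.
have nth_v i : nth 0%N (u ++ v) (size u + i) = nth 0%N v i.
  by rewrite nth_cat ltnNge leq_addr addKn.
split=> [[/andP[u_pos v_pos] uv_dec]|[[u_pos u_dec] [v_pos v_dec]]].
  split; split=> // j lt_j ndvd.
    have := uv_dec j; rewrite !nth_u ?(ltnW lt_j) //; apply=> //.
    exact: ltn_addr.
  have := uv_dec (size u + j)%N.
  by rewrite -addnS !nth_v ltn_add2l dvdn_addr //; apply.
split=> [|j lt_j ndvd]; first exact/andP.
have [lt_ju|lt_uj|eq_ju] := ltngtP j.+1 (size u).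
- by rewrite !nth_u ?(ltnW lt_ju) //; apply: u_dec.
- have j_eq : j = (size u + (j - size u))%N by rewrite subnKC.
  move: lt_j ndvd; rewrite j_eq -addnS !nth_v ltn_add2l dvdn_addr //.
  exact: v_dec.
- by rewrite eq_ju k_u in ndvd.
Qed.

Lemma block_arndt_decomp k : (0 < k)%N ->
  block_arndt k = \bigcup_(j < k) strict_partitions j `|`
    (fun p => p.1 ++ p.2) @` (strict_partitions k `*` block_arndt k).
Proof.
move=> k_gt0; apply/seteqP; split=> [s arndt_s|s].
  have [lt_sk|le_ks] := ltnP (size s) k.
    left; exists (size s) => //.
    exact/(block_arndt_short k_gt0 (ltnW lt_sk)).
  right; exists (take k s, drop k s); last exact: cat_take_drop.
  have sz_take : size (take k s) = k by exact: size_takel.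
  move: arndt_s; rewrite -{1}(cat_take_drop k s) block_arndt_cat ?sz_take //.
  by rewrite block_arndt_short ?sz_take.
move=> [[j /= lt_jk s_strict]|[[u v] [/= u_strict v_arndt] <-]].
  have [_ sz_s _] := s_strict.
  by apply/(block_arndt_short k_gt0); rewrite sz_s // ltnW.
have [_ sz_u _] := u_strict.
apply/(block_arndt_cat _ k_gt0); first by rewrite sz_u.
by split=> //; apply/(block_arndt_short k_gt0); rewrite sz_u.
Qed.

Theorem theorem5p1 (k : nat) (hk : (0 < k)%N) :
  fps2_has_sum (block_arndt k)
    (fun s : seq nat => xvar ^+ (sumn s) * yvar ^+ (size s))
    ((1 - J k)^-1 * \sum_(0 <= j < k) J j).
Proof.
apply: fps2_has_sum_weight_rec => [|S arndt_S]; first exact: unit_1BJ.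
rewrite {1}block_arndt_decomp //; apply: fps2_has_sum_setU.
- move=> s [[j /= lt_jk [_ sz_s _]] [[u v] [/= [_ sz_u _] _] uv_s]].
  by move: lt_jk; rewrite -sz_s -uv_s size_cat sz_u ltnNge leq_addr.
- apply: fps2_has_sum_bigcup; first exact: trivIset_strict_partitions.
  exact: fps2_has_sum_strict_partitions.
- apply: (@fps2_has_sum_cat _ _ k) => // [s []//|].
  exact: fps2_has_sum_strict_partitions.
Qed.
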